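(* Let $\mathrm{L}_\sigma$ be an admissible expansion of Łukasiewicz logic. If $T$ is a theory and $\varphi$ is a formula, both in the $\sigma$-Pavelka expansion of Ł, then $|\varphi|_T=\|\varphi\|_T$.
   Context: Łukasiewicz logic Ł has connectives $\rightarrow$ and $0$, with $\neg\alpha:=\alpha\rightarrow0$, $1:=\neg0$, $\alpha\odot\beta:=\neg(\alpha\rightarrow\neg\beta)$, axioms all instances of $\alpha\rightarrow(\beta\rightarrow\alpha)$, $(\alpha\rightarrow\beta)\rightarrow((\beta\rightarrow\gamma)\rightarrow(\alpha\rightarrow\gamma))$, $(\neg\alpha\rightarrow\neg\beta)\rightarrow(\beta\rightarrow\alpha)$, $((\alpha\rightarrow\beta)\rightarrow\beta)\rightarrow((\beta\rightarrow\alpha)\rightarrow\alpha)$, and Modus Ponens as only rule; it is algebraizable in the variety $\mathcal{MV}$ of MV-algebras with equivalence formulas $\{p\rightarrow q,q\rightarrow p\}$ (written $p\Leftrightarrow q$) and defining equation $p\approx p\rightarrow p$. For new operation symbols $\sigma$ and equations $E(\sigma)$, $\mathcal{MV}_{E(\sigma)}$ is the variety axiomatized by the MV-axioms plus $E(\sigma)$; it is a compatible expansion if for each of its members the congruences coincide with those of the MV-reduct, and it is admissible if (1) the standard MV-algebra $[0,1]_{MV}$ ($x\odot y=\max(0,x+y-1)$, $x\rightarrow y=\min(1,1-x+y)$) admits a canonical $E(\sigma)$-expansion $[0,1]_{E(\sigma)}$ (a unique family of operations on $[0,1]$ making it an $\mathcal{MV}_{E(\sigma)}$-algebra, each subalgebra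 admitting at most one such family), and (2) the subalgebra $\mathbb{Q}\cap[0,1]$ admits an $E(\sigma)$-expansion. An admissible expansion of Ł is a logic $\mathrm{L}_\sigma$ obtained by adding connectives $\sigma$ and axioms to Ł (Modus Ponens the only rule), algebraizable in an admissible $\mathcal{MV}_{E(\sigma)}$. The $\sigma$-Pavelka expansion is obtained from $\mathrm{L}_\sigma$ by adding a truth constant $\overline r$ for each $r\in\mathbb{Q}\cap[0,1]$ and the book-keeping axioms $\overline0\Leftrightarrow0$, $(\overline r\rightarrow\overline s)\Leftrightarrow\overline{r\rightarrow s}$, and $f(\overline{r_1},\dots,\overline{r_n})\Leftrightarrow\overline{f(r_1,\dots,r_n)}$ for each $n$-ary $f\in\sigma$ and $r_i\in\mathbb{Q}\cap[0,1]$ (operations on rationals computed in the $E(\sigma)$-expansion of $[0,1]$). A theory is a set of formulas closed under derivability. A valuation is a homomorphism $v$ from the formulas of the Pavelka expansion into $[0,1]_{E(\sigma)}$ with $\overline r$ interpreted as $r$; $v(T)=1$ means $v(\alpha)=1$ for all $\alpha\in T$. The truth degree is $\|\varphi\|_T=\bigwedge\{v(\varphi): v(T)=1\}$ and the proof degree is $|\varphi|_T=\bigvee\{r\in\mathbb{Q}\cap[0,1]:\ \overline r\rightarrow\varphi\in T\}$. *)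

(* Defs.v *)
From mathcomp Require Import all_boot all_order all_algebra.
From mathcomp Require Import all_classical reals.

Set Implicit Arguments.
Unset Strict Implicit.
Unset Printing Implicit Defensive.

Import Order.TTheory GRing.Theory Num.Theory.
Local Open Scope classical_set_scope.
Local Open Scope ring_scope.

(** * Formulas and algebras *)

(* A signature lists only the operation symbols added to the Lukasiewicz
   language {->, 0}. *)
Record signature := Signature { symbol :> Type; arity : symbol -> nat }.

Definition no_ops : signature := @Signature void (fun=> 0%N).

(* C is the set of truth constants: [void] for the language of L_sigma, the
   rationals of [0, 1] for its Pavelka expansion. *)
Inductive formula (S : signature) (C : Type) : Type :=
| Var of nat
| Const of C
| Bot
| Imp of formula S C & formula S C
| Op (f : S) of 'I_(arity f) -> formula S C.

Arguments Var {S C}.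
Arguments Const {S C}.
Arguments Bot {S C}.

Definition operations (S : signature) (A : Type) :=
  forall f : S, ('I_(arity f) -> A) -> A.

Definition eq_operations S A (F G : operations S A) :=
  forall (f : S) (x : 'I_(arity f) -> A), F f x = G f x.

Record algebra (S : signature) := Algebra {
  carrier :> Type;
  bot : carrier;
  imp : carrier -> carrier -> carrier;
  op : operations S carrier
}.

Arguments bot {S} a.
Arguments imp {S a}.
Arguments op {S} a f.

Definition formula_algebra S C : algebra S :=
  @Algebra S (formula S C) Bot (@Imp S C) (@Op S C).

Definition mv_reduct S (A : algebra S) : algebra no_ops :=
  @Algebra no_ops A (bot A) imp (fun f => match f with end).

Definition expand S (A : algebra no_ops) (F : operations S A) : algebra S :=
  @Algebra S A (bot A) imp F.

Record is_hom S (A B : algebra S) (h : A -> B) : Prop := IsHom {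
  hom_bot : h (bot A) = bot B;
  hom_imp : forall x y, h (imp x y) = imp (h x) (h y);
  hom_op : forall f x, h (op A f x) = op B f (fun i => h (x i))
}.

Record is_congruence S (A : algebra S) (e : A -> A -> Prop) : Prop :=
  IsCongruence {
  congr_refl : forall x, e x x;
  congr_sym : forall x y, e x y -> e y x;
  congr_trans : forall x y z, e x y -> e y z -> e x z;
  congr_imp : forall x x' y y', e x x' -> e y y' -> e (imp x y) (imp x' y');
  congr_op : forall f x y, (forall i, e (x i) (y i)) -> e (op A f x) (op A f y)
}.

Record is_subuniverse S (A : algebra S) (B : set A) : Prop := IsSubuniverse {
  sub_bot : B (bot A);
  sub_imp : forall x y, B x -> B y -> B (imp x y);
  sub_op : forall f x, (forall i, B (x i)) -> B (op A f x)
}.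

Definition subalgebra S (A : algebra S) (B : set A) (hB : is_subuniverse B) :
    algebra S :=
  @Algebra S {x : A | B x}
    (exist _ _ (sub_bot hB))
    (fun x y => exist _ _ (sub_imp hB (proj2_sig x) (proj2_sig y)))
    (fun f x => exist _ _ (sub_op hB (fun i => proj2_sig (x i)))).

(** * The varieties MV_E(sigma) *)

Definition neg S (A : algebra S) (x : A) : A := imp x (bot A).
Definition oplus S (A : algebra S) (x y : A) : A := imp (neg x) y.

(* The usual axioms of MV-algebras in (+, ~, 0), read through the definitions
   of ~ and + from -> and 0; conversely [mv_negK] makes x -> y equal to
   ~x + y. *)
Record is_mv S (A : algebra S) : Prop := IsMV {
  mv_oplusA : forall x y z : A, oplus x (oplus y z) = oplus (oplus x y) z;
  mv_oplusC : forall x y : A, oplus x y = oplus y x;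
  mv_oplus0 : forall x : A, oplus x (bot A) = x;
  mv_negK : forall x : A, neg (neg x) = x;
  mv_oplus1 : forall x : A, oplus x (neg (bot A)) = neg (bot A);
  mv_lukasiewicz : forall x y : A,
    oplus (neg (oplus (neg x) y)) y = oplus (neg (oplus (neg y) x)) x
}.

Definition equations S := formula S void -> formula S void -> Prop.

Definition satisfies S (A : algebra S) (E : equations S) :=
  forall s t, E s t ->
  forall h : formula_algebra S void -> A, is_hom h -> h s = h t.

Definition in_variety S (E : equations S) (A : algebra S) :=
  is_mv A /\ satisfies A E.

Definition is_expansion S (E : equations S) (A : algebra no_ops)
  (F : operations S A) := in_variety E (expand F).

(** * Standard MV-algebras *)

Definition I01 (K : realFieldType) := {x : K | 0 <= x <= 1}.

Lemma zero01_subproof (K : realFieldType) : 0 <= (0 : K) <= 1.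
Proof. by rewrite lexx ler01. Qed.

Definition zero01 (K : realFieldType) : I01 K :=
  exist _ 0 (zero01_subproof K).

Lemma imp01_subproof (K : realFieldType) (x y : I01 K) :
  0 <= Num.min 1 (1 - val x + val y) <= 1.
Proof.
case: x y => [x /= /andP[x0 x1]] [y /= /andP[y0 y1]].
by rewrite le_min ler01 addr_ge0 ?subr_ge0 // ge_min lexx.
Qed.

Definition imp01 (K : realFieldType) (x y : I01 K) : I01 K :=
  exist _ (Num.min 1 (1 - val x + val y)) (imp01_subproof x y).

Definition standard_mv (K : realFieldType) : algebra no_ops :=
  @Algebra no_ops (I01 K) (zero01 K) (@imp01 K) (fun f => match f with end).

Record canonical_expansion (R : realType) S (E : equations S)
    (F : operations S (standard_mv R)) : Prop := CanonicalExpansion {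
  canonical_exp : is_expansion E F;
  canonical_uniq : forall G : operations S (standard_mv R),
    is_expansion E G -> eq_operations G F;
  canonical_sub : forall (B : set (standard_mv R)) (hB : is_subuniverse B)
      (G H : operations S (subalgebra hB)),
    is_expansion E G -> is_expansion E H -> eq_operations G H
}.

Record admissible_variety (R : realType) S (E : equations S) : Prop :=
  AdmissibleVariety {
  admissible_canonical :
    exists F : operations S (standard_mv R), canonical_expansion E F;
  admissible_rat : exists F : operations S (standard_mv rat), is_expansion E F
}.

(** * Lukasiewicz logic and its expansions *)

Section Logic.
Context {S : signature}.

Notation "a ~> b" := (Imp a b) (at level 55, right associativity).
Notation "~~~ a" := (Imp a Bot) (at level 35, right associativity).

Inductive derives {C} (axiom G : set (formula S C)) : set (formula S C) :=
| der_hyp a : G a -> derives axiom G a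
| der_axiom a : axiom a -> derives axiom G a
| der_mp a b : derives axiom G a -> derives axiom G (a ~> b) ->
    derives axiom G b.

Inductive luk_axiom {C} : set (formula S C) :=
| luk1 a b : luk_axiom (a ~> (b ~> a))
| luk2 a b c : luk_axiom ((a ~> b) ~> ((b ~> c) ~> (a ~> c)))
| luk3 a b : luk_axiom ((~~~ a ~> ~~~ b) ~> (b ~> a))
| luk4 a b : luk_axiom (((a ~> b) ~> b) ~> ((b ~> a) ~> a)).

(* The axioms Ax added to Lukasiewicz logic are schemata: their instances are
   taken in the language at hand, truth constants included. *)
Inductive sigma_axiom (Ax : set (formula S void)) {C} : set (formula S C) :=
| sigma_luk a : luk_axiom a -> sigma_axiom Ax a
| sigma_inst a (s : formula_algebra S void -> formula_algebra S C) :
    Ax a -> is_hom s -> sigma_axiom Ax (s a).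

(* L_sigma is algebraizable, in the sense of Blok and Pigozzi, with the
   equivalence formulas {p -> q, q -> p} and the defining equation
   p = p -> p of Lukasiewicz logic. *)
Record algebraizable (Ax : set (formula S void)) (E : equations S) : Prop :=
  Algebraizable {
  algebraizable_cons : forall (G : set (formula S void)) (a : formula S void),
    derives (sigma_axiom Ax) G a <->
    forall A : algebra S, in_variety E A ->
    forall h : formula_algebra S void -> A, is_hom h ->
    (forall g, G g -> h g = h (g ~> g)) -> h a = h (a ~> a);
  algebraizable_equiv : forall A : algebra S, in_variety E A ->
    forall x y : A, x = y <->
      imp x y = imp (imp x y) (imp x y) /\ imp y x = imp (imp y x) (imp y x)
}.

Definition admissible_expansion (R : realType) (Ax : set (formula S void))
    (E : equations S) :=
  algebraizable Ax E /\ admissible_variety R E.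

(* Compatibility is not repeated among the conditions defining admissibility:
   since modus ponens is the only rule, algebraizability entails it. *)
Definition compatible_expansion (E : equations S) :=
  forall A : algebra S, in_variety E A -> forall e : A -> A -> Prop,
  is_congruence (A := A) e <-> is_congruence (A := mv_reduct A) e.

Fixpoint eval (A : algebra S) (v : nat -> A) (a : formula S void) : A :=
  match a with
  | Var n => v n
  | Const c => match c with end
  | Bot => bot A
  | Imp b c => imp (eval v b) (eval v c)
  | Op f x => op A f (fun i => eval v (x i))
  end.

Lemma eval_hom (A : algebra S) (v : nat -> A) :
  is_hom (A := formula_algebra S void) (eval v).
Proof. by []. Qed.

Lemma algebraizable_compatible (Ax : set (formula S void)) (E : equations S) :
  algebraizable Ax E -> compatible_expansion E.
Proof.
move=> [cons equiv] A VA e; split=> [] [er es et ei eo]; split=> //.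
move=> f x y exy; have [mvA _] := VA.
have impE (u v : A) : oplus (neg u) v = imp u v.
  by rewrite /oplus (mv_negK mvA).
have imp1 (u : A) : imp (neg (bot A)) u = u.
  by rewrite -[LHS]/(oplus (bot A) u) (mv_oplusC mvA) (mv_oplus0 mvA).
have impxx (u : A) : imp u u = neg (bot A).
  have := mv_lukasiewicz mvA u (neg (bot A)).
  by rewrite (mv_oplus1 mvA) (mv_negK mvA) (mv_oplusC mvA (bot A))
    (mv_oplus0 mvA) impE.
have luk (u v : A) : imp (imp u v) v = imp (imp v u) u.
  by rewrite -!impE (mv_lukasiewicz mvA).
have eE (u v : A) : e (imp u v) (neg (bot A)) -> e (imp v u) (neg (bot A)) ->
    e u v.
  move=> uv vu; apply: (et _ (imp (imp u v) v)); last first.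
    by have := ei _ _ _ _ uv (er v); rewrite /= imp1.
  by rewrite luk; apply: es; have := ei _ _ _ _ vu (er u); rewrite /= imp1.
pose h := eval (fun n => if insub n./2 is Some i then
  if odd n then y i else x i else bot A).
have hh : is_hom (A := formula_algebra S void) h by exact: eval_hom.
pose p (i : 'I_(arity f)) : formula S void := Var i.*2.
pose q (i : 'I_(arity f)) : formula S void := Var i.*2.+1.
have hp i : h (p i) = x i by rewrite /h /= doubleK valK odd_double.
have hq i : h (q i) = y i by rewrite /h /= uphalf_double valK odd_double.
pose G : set (formula S void) :=
  [set a | exists i, a = (p i ~> q i) \/ a = (q i ~> p i)].
have sound a : derives (sigma_axiom Ax) G a -> e (h a) (neg (bot A)).
  elim=> {a} [a [i [] ->] | a axa | a b _ ea _ eab].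
  - rewrite (hom_imp hh) hp hq.
    by have := ei _ _ _ _ (exy i) (er (y i)); rewrite /= impxx.
  - rewrite (hom_imp hh) hp hq.
    by have := ei _ _ _ _ (er (y i)) (exy i); rewrite /= impxx.
  - have /cons ha : derives (sigma_axiom Ax) set0 a by exact: der_axiom.
    have := ha A VA h hh (fun g => False_ind _).
    by rewrite (hom_imp hh) impxx => ->.
  - apply: et eab; rewrite (hom_imp hh); apply: es.
    by have := ei _ _ _ _ ea (er (h b)); rewrite /= imp1.
have opE : (fun i => h (p i)) = x /\ (fun i => h (q i)) = y.
  by split; apply: funext.
have pq (B : algebra S) (k : formula_algebra S void -> B) :
    in_variety E B -> is_hom k ->
    (forall g, G g -> k g = k (g ~> g)) -> k (Op p) = k (Op q).
  move=> VB hk kG; rewrite !(hom_op hk); congr op; apply: funext => i.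
  apply/(equiv _ VB); split; rewrite -!(hom_imp hk); apply: kG; exists i;
    by [left | right].
have der_pq : derives (sigma_axiom Ax) G (Op p ~> Op q).
  apply/cons => B VB k hk kG; rewrite !(hom_imp hk) (pq _ _ VB hk kG).
  by have [/(_ erefl)[]] := equiv _ VB (k (Op q)) (k (Op q)).
have der_qp : derives (sigma_axiom Ax) G (Op q ~> Op p).
  apply/cons => B VB k hk kG; rewrite !(hom_imp hk) (pq _ _ VB hk kG).
  by have [/(_ erefl)[]] := equiv _ VB (k (Op q)) (k (Op q)).
have [<- <-] := opE; rewrite -!(hom_op hh).
by apply: eE; rewrite -(hom_imp hh); apply: sound.
Qed.

(** * Pavelka expansions *)

Definition rat01 (R : realType) (r : I01 rat) : R := ratr (val r).

Inductive iff_pair {C} (a b : formula S C) : set (formula S C) :=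
| iff_lr : iff_pair a b (a ~> b)
| iff_rl : iff_pair a b (b ~> a).

(* [bk_op] is stated for every rational s equal to f(r_1, ..., r_n); such an s
   always exists when F is the canonical expansion of an admissible one. *)
Inductive pavelka_axiom {R : realType} (Ax : set (formula S void))
    (F : operations S (standard_mv R)) : set (formula S (I01 rat)) :=
| pavelka_sigma a : sigma_axiom Ax a -> pavelka_axiom Ax F a
| bk_bot a : iff_pair (Const (zero01 rat)) Bot a -> pavelka_axiom Ax F a
| bk_imp r s a : iff_pair (Const r ~> Const s) (Const (imp01 r s)) a ->
    pavelka_axiom Ax F a
| bk_op (f : S) (r : 'I_(arity f) -> I01 rat) (x : 'I_(arity f) -> I01 R)
    (s : I01 rat) a :
    (forall i, val (x i) = rat01 R (r i)) -> rat01 R s = val (F f x) ->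
    iff_pair (Op (fun i => Const (r i))) (Const s) a -> pavelka_axiom Ax F a.

Definition is_theory {R : realType} (Ax : set (formula S void))
    (F : operations S (standard_mv R)) (T : set (formula S (I01 rat))) :=
  forall a, derives (pavelka_axiom Ax F) T a -> T a.

Record is_valuation {R : realType} (F : operations S (standard_mv R))
    (v : formula_algebra S (I01 rat) -> expand F) : Prop := IsValuation {
  valuation_hom : is_hom v;
  valuation_const : forall r : I01 rat, val (v (Const r) : I01 R) = rat01 R r
}.

(* Joins and meets in the complete lattice [0, 1]: the join of set0 is 0 and
   its meet is 1, whereas [inf set0 = 0]. *)
Definition join01 {R : realType} (X : set R) : R := sup (0 |` X).
Definition meet01 {R : realType} (X : set R) : R := inf (1 |` X).

Definition truth_degree {R : realType} (F : operations S (standard_mv R))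
    (T : set (formula S (I01 rat))) (a : formula S (I01 rat)) : R :=
  meet01 [set x | exists v : formula_algebra S (I01 rat) -> expand F,
    [/\ is_valuation v, (forall b, T b -> val (v b : I01 R) = 1)
      & x = val (v a : I01 R)]].

Definition proof_degree (R : realType) (T : set (formula S (I01 rat)))
    (a : formula S (I01 rat)) : R :=
  join01 [set x | exists2 r : I01 rat, T (Const r ~> a) & x = rat01 R r].

End Logic.

(* Main.v *)
Require Import Defs.
From mathcomp Require Import all_boot all_order all_algebra.
From mathcomp Require Import all_classical reals.
From mathcomp Require Import lra.

(** Soundness is immediate. For the converse, let r be a rational such that
    r -> phi is not in T. A theory M containing T that is maximal without
    r -> phi is linear, by prelinearity, so phi -> r is in M; and
    v(a) := |a|_M preserves implication, sends each constant r to r and M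
    to 1, and satisfies v(phi) <= r.

    It remains to see that v preserves each f in sigma. By algebraizability,
    f(p) -> f(q) is derivable from the equivalences p_i <-> q_i; since modus
    ponens only adds up the distances to 1 of its premises, v(f(a_1,...,a_n))
    is a Lipschitz function of v(a_1),...,v(a_n). The values of v are dense,
    so this function extends to [0, 1]; the resulting operations satisfy E
    by continuity, hence they are the canonical ones. *)

Set Implicit Arguments.
Unset Strict Implicit.
Unset Printing Implicit Defensive.

Import Order.TTheory GRing.Theory Num.Theory.
Local Open Scope classical_set_scope.
Local Open Scope ring_scope.

(** * Derivations in Lukasiewicz logic *)

Lemma mv_impxx S (A : algebra S) (x : A) : is_mv A -> imp x x = neg (bot A).
Proof.
move=> mvA; have := mv_lukasiewicz mvA x (neg (bot A)).
rewrite (mv_oplus1 mvA) (mv_negK mvA) (mv_oplusC mvA (bot A)).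
by rewrite (mv_oplus0 mvA) /oplus (mv_negK mvA).
Qed.

(** In an MV-algebra [imp (imp u v) v] is the join of [u] and [v], so this is prelinearity in join
    form. The calculation is purely equational and appeals to no representation by chains. *)
Lemma mv_prelinear S (A : algebra S) (x y : A) : is_mv A ->
  imp (imp (imp x y) (imp y x)) (imp y x) = neg (bot A).
Proof.
move=> mvA.
pose n := @neg S A; pose a := @oplus S A.
have aA : associative a by exact: mv_oplusA.
have aC : commutative a by exact: mv_oplusC.
have nK : involutive n by exact: mv_negK.
have impE u w : imp u w = a (n u) w by rewrite /a /oplus -/(n _) nK.
have aACA : interchange a a.
  by move=> u w s t; rewrite -!aA [a w (a s t)]aA [a w s]aC -aA.
(* Both sides are the join of [u] and [w], whose symmetry is the last MV-axiom. *)
have aJ u w : a u (n (a u (n w))) = a w (n (a w (n u))).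
  rewrite aC [a u (n w)]aC [a w (n u)]aC [a w _]aC.
  exact: mv_lukasiewicz.
have anx u : a u (n u) = n (bot A) by rewrite aC -impE mv_impxx.
rewrite !impE; set p := a (n x) y; set q := a (n y) x.
(* Commuting the join of p and q, and then the joins that appear inside it,
   uncovers the summands x and ~x. *)
pose c := n (a (n x) (n q)).
have pq : a p (n q) = a y (n c) by rewrite nK [p]aC aA.
have xc : a (n x) c = a q (n (a q x)) by rewrite aJ nK.
have yc : a (n y) (n (a c (n y))) = a (n c) (n (a (n c) y)).
  by rewrite [a c _]aC -{1}[c]nK aJ nK.
rewrite aC [a (n p) q]aC aJ pq -aA aJ aA xc -aA [a (n (a q x)) _]aC.
rewrite [a q _]aACA yc nK -[a (a (n x) (n q)) _]aA aACA [a (n x) x]aC anx.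
by rewrite aC; exact: mv_oplus1.
Qed.

Section Hilbert.
Context {S : signature}.
Local Notation "a ~> b" := (@Imp S _ a b) (at level 55, right associativity).

Lemma derives_sub C (ax G H : set (formula S C)) :
  G `<=` derives ax H -> derives ax G `<=` derives ax H.
Proof.
by move=> GH a; elim=> {a} [a /GH | a /der_axiom | a b _ + _] //; exact: der_mp.
Qed.

Lemma sigma_axiom_subst (Ax : set (formula S void)) C
    (s : formula_algebra S void -> formula_algebra S C) a : is_hom s ->
  sigma_axiom Ax a -> sigma_axiom Ax (s a).
Proof.
move=> hs; have sI x y : s (x ~> y) = s x ~> s y := hom_imp hs x y.
have sB : s Bot = Bot := hom_bot hs.
case=> {a} [a | a t Axa ht].
  by case=> *; rewrite !sI ?sB; apply: sigma_luk;
    [exact: luk1 | exact: luk2 | exact: luk3 | exact: luk4].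
have hst : is_hom (s \o t).
  split=> [|x y|f x] /=; first by rewrite (hom_bot ht) (hom_bot hs).
    by rewrite (hom_imp ht) (hom_imp hs).
  by rewrite (hom_op ht) (hom_op hs).
exact: (sigma_inst Axa hst).
Qed.

(** Algebraizability speaks of formulas without truth constants; through structurality its
    consequences reach formulas with constants. *)
Lemma derives_subst (Ax : set (formula S void)) C (G : set (formula S void))
    (s : formula_algebra S void -> formula_algebra S C) a : is_hom s ->
  derives (sigma_axiom Ax) G a -> derives (sigma_axiom Ax) (s @` G) (s a).
Proof.
move=> hs; elim=> {a} [a Ga | a axa | a b _ IHa _ IHab].
- by apply: der_hyp; exists a.
- by apply: der_axiom; exact: sigma_axiom_subst.
- by apply: der_mp IHa _; rewrite -[Imp _ _](hom_imp hs).
Qed.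

Lemma derives_prelinear Ax E C (G : set (formula S C)) a b :
  algebraizable Ax E ->
  derives (sigma_axiom Ax) G (((a ~> b) ~> b ~> a) ~> b ~> a).
Proof.
move=> [cons _].
pose x : formula S void := Var 0; pose y : formula S void := Var 1.
have prel : derives (sigma_axiom Ax) set0 (((x ~> y) ~> y ~> x) ~> y ~> x).
  apply/cons => A [mvA _] h hh _.
  have hI u w : h (u ~> w) = imp (h u) (h w) := hom_imp hh u w.
  by rewrite !hI mv_prelinear // mv_impxx.
have /(derives_subst (eval_hom _)) := prel.
move=> /(_ _ (fun n => if n is 0%N then a else b)).
by rewrite image_set0; apply: derives_sub.
Qed.

(** * Linear extensions of theories *)

Section Deduction.
Variables (C : Type) (ax : set (formula S C)).
Hypothesis ax_luk : luk_axiom `<=` ax.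
Hypothesis ax_prelinear : forall G a b,
  derives ax G (((a ~> b) ~> b ~> a) ~> b ~> a).
Implicit Types (G : set (formula S C)) (a b c : formula S C).

Lemma derives_luk G a : luk_axiom a -> derives ax G a.
Proof. by move/ax_luk; exact: der_axiom. Qed.

Lemma derives_weak G a b : derives ax G b -> derives ax G (a ~> b).
Proof. by move=> /der_mp; apply; apply: derives_luk; exact: luk1. Qed.

Lemma derives_trans G a b c :
  derives ax G (a ~> b) -> derives ax G (b ~> c) -> derives ax G (a ~> c).
Proof.
move=> ab /der_mp; apply; apply: der_mp ab _; apply: derives_luk; exact: luk2.
Qed.

Lemma derives_suffix G a b c :
  derives ax G (a ~> b) -> derives ax G ((b ~> c) ~> a ~> c).
Proof. by move=> /der_mp; apply; apply: derives_luk; exact: luk2. Qed.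

(** The two axioms chain through [(b ~> a) ~> a], a join that [luk4] commutes. *)
Lemma derives_assertion G a b : derives ax G (a ~> (a ~> b) ~> b).
Proof.
apply: (@derives_trans _ _ ((b ~> a) ~> a)); apply: derives_luk.
  exact: luk1.
exact: luk4.
Qed.

Lemma derives_exchange G a b c :
  derives ax G ((a ~> b ~> c) ~> b ~> a ~> c).
Proof.
apply: (@derives_trans _ _ (((b ~> c) ~> c) ~> a ~> c)).
  by apply: derives_luk; exact: luk2.
exact/derives_suffix/derives_assertion.
Qed.

Lemma derives_swap G a b c :
  derives ax G (a ~> b ~> c) -> derives ax G (b ~> a ~> c).
Proof. by move=> /der_mp; apply; exact: derives_exchange. Qed.

Lemma derives_prefix G a b c :
  derives ax G (b ~> c) -> derives ax G ((a ~> b) ~> a ~> c).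
Proof.
by move=> /der_mp; apply; apply/derives_swap/derives_luk; exact: luk2.
Qed.

Lemma derives_id G a : derives ax G (a ~> a).
Proof.
have ax0 : derives ax G (a ~> a ~> a) by apply: derives_luk; exact: luk1.
by apply: der_mp ax0 _; apply/derives_swap/derives_luk; exact: luk1.
Qed.

Lemma derives_exfalso G a : derives ax G (Bot ~> a).
Proof.
apply: der_mp (derives_luk _ (luk3 a Bot)).
by apply: derives_weak; exact: derives_id.
Qed.

(** By prelinearity the join of [a ~> b] and [b ~> a] is derivable. Its first member may be replaced
    by the weaker [c]; commuting the new join with [luk4] then leaves [c]. *)
Lemma derives_cases G a b c :
  derives ax G ((a ~> b) ~> c) -> derives ax G ((b ~> a) ~> c) ->
  derives ax G c.
Proof.
move=> ac bc; have := derives_suffix (b ~> a) (derives_suffix (b ~> a) ac).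
move=> /(der_mp (ax_prelinear G a b)) cb.
by apply: der_mp bc _; apply: der_mp cb _; apply: derives_luk; exact: luk4.
Qed.

Lemma derives_iter_weak G n a b :
  derives ax G b -> derives ax G (iter n (Imp a) b).
Proof. by move=> Gb; elim: n => //= n; exact: derives_weak. Qed.

Lemma derives_iter_intro G n a b : derives ax G (b ~> iter n (Imp a) b).
Proof.
elim: n => [|n] /=; first exact: derives_id.
by move/derives_trans; apply; apply: derives_luk; exact: luk1.
Qed.

Lemma derives_iter_mono G n a b c :
  derives ax G ((b ~> c) ~> iter n (Imp a) b ~> iter n (Imp a) c).
Proof.
elim: n => [|n] /=; first exact: derives_id.
by move/derives_trans; apply; apply/derives_swap/derives_luk; exact: luk2.
Qed.

Lemma derives_iter_swap G n a b c :
  derives ax G (iter n (Imp a) (b ~> c) ~> b ~> iter n (Imp a) c).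
Proof.
elim: n => [|n /(derives_prefix a)] /=; first exact: derives_id.
by move/derives_trans; apply; exact: derives_exchange.
Qed.

(** Contraction fails in Łukasiewicz logic, so the uses of [a] are counted; modus ponens adds the
    counts of its premises. *)
Lemma deduction G a b : derives ax (G `|` [set a]) b ->
  exists n, derives ax G (iter n (Imp a) b).
Proof.
elim=> {b} [b [Gb | ->] | b axb | b c _ [n Gb] _ [m Gbc]].
- by exists 0%N; exact: der_hyp.
- by exists 1%N; exact: derives_id.
- by exists 0%N; exact: der_axiom.
- exists (m + n)%N; rewrite iterD; apply: der_mp Gbc _.
  apply: der_mp (derives_iter_mono _ _ _ _ _).
  by apply: der_mp Gb _; apply/derives_swap/derives_iter_mono.
Qed.

(* Every word of length n + m in the premises a -> b and b -> a contains the
   first one n times or the second one m times; proof by cases then shortens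
   the words one letter at a time. *)
Lemma derives_iter_cases G n m a b c :
  derives ax G (iter n (Imp (a ~> b)) c) ->
  derives ax G (iter m (Imp (b ~> a)) c) -> derives ax G c.
Proof.
set x := a ~> b; set y := b ~> a => xc yc.
pose W k l := iter k (Imp x) (iter l (Imp y) c).
suff: forall k l, derives ax G (W k l) by move/(_ 0 0)%N.
suff H N k l : (n + m - N <= k + l)%N -> derives ax G (W k l).
  by move=> k l; apply: (H (n + m)%N); rewrite subnn.
elim: N k l => [|N IHN] k l.
  rewrite subn0 => nmkl; have [nk | kn] := leqP n k.
    rewrite /W -(subnK nk) iterD; apply: derives_iter_weak; apply: der_mp xc _.
    apply: der_mp (derives_iter_mono _ _ _ _ _); exact: derives_iter_intro.
  have ml : (m <= l)%N.
    by rewrite -(leq_add2l n) (leq_trans nmkl) // leq_add2r ltnW.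
  by rewrite /W -(subnK ml) iterD; do 2 apply: derives_iter_weak.
rewrite subnS -subn1 leq_subLR add1n => Nkl; apply: (@derives_cases _ a b).
  by apply: (IHN k.+1 l); rewrite addSn.
apply: der_mp (derives_iter_swap _ _ _ _ _).
by apply: (IHN k l.+1); rewrite addnS.
Qed.

(** Zorn's lemma yields [A] maximal among the sets which, added to [G], do not derive [c]. If
    neither implication were in the closure [M], each of them, used finitely often, would give [c]
    over [M], and [derives_iter_cases] would put [c] into [M]. *)
Lemma linear_extension G c : ~ derives ax G c ->
  exists M : set (formula S C),
    [/\ G `<=` M, derives ax M `<=` M, ~ M c
      & forall a b, M (a ~> b) \/ M (b ~> a)].
Proof.
move=> Gc.
have [F FP Ftot|A [Ac Amax]] :=
    @Zorn_bigcup _ [set X | ~ derives ax (G `|` X) c].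
  (* Derivations are finite, so one member of the chain contains all hypotheses taken from the
     union. The first alternative, where none is taken, covers the empty chain. *)
  have fin a : derives ax (G `|` \bigcup_(X in F) X) a ->
      derives ax G a \/ exists2 X, F X & derives ax (G `|` X) a.
    elim=> {a} [a [Ga | [X FX Xa]] | a axa | a b _ IHa _ IHab].
    - by left; exact: der_hyp.
    - by right; exists X => //; apply: der_hyp; right.
    - by left; exact: der_axiom.
    - have wk X d : derives ax G d -> derives ax (G `|` X) d.
        by apply: derives_sub => e Ge; apply: der_hyp; left.
      have mono X Y d : X `<=` Y ->
          derives ax (G `|` X) d -> derives ax (G `|` Y) d.
        move=> XY; apply: derives_sub => e Xe; apply: der_hyp.
        exact: setUS Xe.
      case: IHa IHab => [Ga | [X FX Xa]] [Gab | [Y FY Yab]].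
      + by left; exact: der_mp Gab.
      + by right; exists Y => //; apply: der_mp Yab; exact: wk.
      + by right; exists X => //; apply: der_mp Xa _; exact: wk.
      + right; have [XY | YX] := Ftot _ _ FX FY.
          by exists Y => //; apply: der_mp Yab; exact: mono Xa.
        by exists X => //; apply: der_mp Xa _; exact: mono Yab.
  by move=> /fin[] // [X /FP].
pose M := derives ax (G `|` A).
have Mext a : ~ M a -> exists n, M (iter n (Imp a) c).
  move=> Ma; apply: deduction; apply: contrapT => ac.
  apply: (Amax (A `|` [set a])); last by rewrite /= setUA.
  split=> [d Ad | sub]; first by left.
  by apply: Ma; apply: der_hyp; right; apply: sub; right.
exists M; split=> // [d Gd | d | a b].
- by apply: der_hyp; left.
- exact: derives_sub.
- apply: contrapT => /not_orP[/Mext[n nc] /Mext[m mc]].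
  by apply: Ac; exact: derives_iter_cases nc mc.
Qed.

End Deduction.
End Hilbert.

(** * Homomorphisms into the canonical expansion *)

Lemma I01_bounds (K : realFieldType) (x : I01 K) : 0 <= val x /\ val x <= 1.
Proof. by case: x => x /= /andP[]. Qed.

Lemma val_imp01 (K : realFieldType) (x y : I01 K) :
  val (imp01 x y) = Num.min 1 (1 - val x + val y).
Proof. by []. Qed.

(* McShane's extension of a Lipschitz function, truncated at 0. *)
Lemma lipschitz_extension (R : realType) T (n : nat) (N : R) (g : T -> I01 R)
    (c : T -> 'I_n -> R) (z : 'I_n -> R) : 0 <= N ->
  (forall x y, `|val (g x) - val (g y)| <= N * \sum_i `|c x i - c y i|) ->
  exists u : I01 R, forall x, `|val u - val (g x)| <= N * \sum_i `|z i - c x i|.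
Proof.
move=> N0 gN.
pose d x : R := N * \sum_i `|z i - c x i|.
have d0 x : 0 <= d x by rewrite mulr_ge0 ?sumr_ge0.
pose X : set R := 0 |` range (fun x => val (g x) - d x).
have Xub b : 0 <= b -> (forall x, val (g x) - d x <= b) -> ubound X b.
  by move=> b0 gb _ [-> | [x _ <-]].
have X0 : X !=set0 by exists 0; left.
have X1 : ubound X 1.
  by apply: Xub => // x; have := I01_bounds (g x); have := d0 x; lra.
have u01 : 0 <= sup X <= 1.
  rewrite ge_sup // andbT; apply: ub_le_sup; [by exists 1 | by left].
pose u : I01 R := Sub (sup X) u01.
exists u => x; rewrite -/(d x) SubK ler_norml; apply/andP; split.
  rewrite -(lerD2r (val (g x))) subrK addrC.
  apply: ub_le_sup; first by exists 1.
  by right; exists x.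
rewrite lerBlDr; apply: ge_sup => //; apply: Xub => [|y].
  by have := I01_bounds (g x); have := d0 x; lra.
suff : val (g y) - val (g x) <= d y + d x by lra.
apply: le_trans (ler_norm _) _; apply: le_trans (gN _ _) _.
rewrite /d -mulrDr -big_split /=; apply: ler_wpM2l => //; apply: ler_sum => i _.
by rewrite [X in _ <= X + _]distrC; exact: ler_distD.
Qed.

(** * Lipschitz continuity of the connectives, read off from derivations *)

Section LipschitzExtension.
Context {R : realType} {S : signature} {C : Type}.
Local Notation "a ~> b" := (@Imp S _ a b) (at level 55, right associativity).
Variables (Ax : set (formula S void)) (E : equations S).
Hypothesis AxE : algebraizable Ax E.
Variable V : formula S C -> I01 R.
Local Notation w a := (val (V a)).
Local Notation substitution :=
  (formula_algebra S void -> formula_algebra S C).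
Hypothesis V_bot : w Bot = 0.
Hypothesis V_imp : forall a b, V (a ~> b) = imp01 (V a) (V b).
Hypothesis V_ax : forall a, sigma_axiom Ax a -> w a = 1.

(** The defect [1 - w] of [a ~> b] is the excess of [w a] over [w b], or 0 if there is none. *)
Lemma defect_mp a b : 1 - w b <= (1 - w a) + (1 - w (a ~> b)).
Proof.
rewrite V_imp val_imp01; have := I01_bounds (V b); have := I01_bounds (V a).
by case: (leP 1 (1 - w a + w b)); lra.
Qed.

(** [N] counts the uses of hypotheses in the derivation, axioms having defect 0. It is fixed before
    the substitution [s], and this uniformity makes it a Lipschitz constant. *)
Lemma derives_defect (G : set (formula S void)) (a : formula S void)
    (D : substitution -> R) :
  (forall s, 0 <= D s) ->
  (forall g (s : substitution), G g -> is_hom s -> 1 - w (s g) <= D s) ->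
  derives (sigma_axiom Ax) G a ->
  exists2 N : R, 0 <= N &
    forall s : substitution, is_hom s -> 1 - w (s a) <= N * D s.
Proof.
move=> D0 GD; elim=> {a} [a Ga | a axa | a b _ [N N0 IHa] _ [M M0 IHab]].
- by exists 1 => // s hs; rewrite mul1r; exact: GD.
- exists 0 => // s hs; rewrite mul0r V_ax ?subrr //; exact: sigma_axiom_subst.
- exists (N + M) => [|s hs]; first exact: addr_ge0.
  apply: (le_trans (defect_mp (s a) (s b))); rewrite mulrDl.
  by apply: lerD; [exact: IHa | rewrite -[Imp _ _](hom_imp hs) IHab].
Qed.

(* The derivation of f(p) -> f(q) from the equivalences p_i <-> q_i, read
   quantitatively: its number of uses of hypotheses is a Lipschitz constant. *)
Lemma op_lipschitz (f : S) : exists2 N : R, 0 <= N &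
  forall x y, `|w (Op x) - w (@Op _ _ f y)| <= N * \sum_i `|w (x i) - w (y i)|.
Proof.
have [cons equiv] := AxE.
(* Even variables carry the arguments of one side and odd ones those of the other, so that a single
   substitution can set both families. *)
pose p (i : 'I_(arity f)) : formula S void := Var i.*2.
pose q (i : 'I_(arity f)) : formula S void := Var i.*2.+1.
pose G : set (formula S void) :=
  [set a | exists i, a = (p i ~> q i) \/ a = (q i ~> p i)].
pose D (s : substitution) : R :=
  \sum_i `|w (s (p i)) - w (s (q i))|.
have D0 s : 0 <= D s by exact: sumr_ge0.
have DG g (s : substitution) : G g -> is_hom s -> 1 - w (s g) <= D s.
  move=> [i gE] hs; apply: (@le_trans _ _ `|w (s (p i)) - w (s (q i))|).
    have := ler_norm (w (s (p i)) - w (s (q i))).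
    have := ler_norm (w (s (q i)) - w (s (p i))); rewrite distrC.
    set z := `|_|; case: gE => ->; rewrite (hom_imp hs) V_imp val_imp01;
      by case: (leP 1 _); lra.
  by rewrite /D (bigD1 i) //= lerDl sumr_ge0.
have der_pq : derives (sigma_axiom Ax) G (Op p ~> Op q).
  apply/cons => B VB k hk kG.
  have kI a b : k (a ~> b) = imp (k a) (k b) := hom_imp hk a b.
  have kpq : k (Op p) = k (Op q).
    rewrite [LHS](hom_op hk) [RHS](hom_op hk); congr op; apply: funext => i.
    by apply/(equiv _ VB); split; rewrite -!kI; apply: kG; exists i;
      [left | right].
  by rewrite !kI kpq !(mv_impxx _ VB.1).
have [N N0 Npq] := derives_defect D0 DG der_pq.
exists N => // x y.
have le x1 y1 : w (Op x1) - w (@Op _ _ f y1) <=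
    N * \sum_i `|w (x1 i) - w (y1 i)|.
  pose s := eval (A := formula_algebra S C) (fun n =>
    if insub n./2 is Some i then if odd n then y1 i else x1 i else Bot).
  have sp i : s (p i) = x1 i by rewrite /s /= doubleK valK odd_double.
  have sq i : s (q i) = y1 i by rewrite /s /= uphalf_double valK odd_double.
  have := Npq s (eval_hom _); rewrite /D.
  under eq_bigr do rewrite sp sq.
  have -> : s (Op p ~> Op q) = Op x1 ~> Op y1.
    by rewrite -(funext sp) -(funext sq).
  move/(le_trans _); apply; rewrite V_imp val_imp01.
  by case: (leP 1 _); lra.
rewrite ler_norml le andbT lerNl opprB.
by under eq_bigr do rewrite distrC.
Qed.

Hypothesis V_dense : forall (x : I01 R) (e : R), 0 < e ->
  exists a, `|w a - val x| <= e.

(** * Approximation of homomorphisms by substitutions *)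

Section Approximation.
Variables (G : operations S (standard_mv R)).
Hypothesis V_op : forall f, exists2 N : R, 0 <= N & forall z x,
  `|val (G z : I01 R) - w (@Op _ _ f x)| <= N * \sum_i `|val (z i) - w (x i)|.

(** Lipschitz bounds compose along [a]: they add at implications, and at [f] those of the arguments
    are summed and multiplied by the constant of [f]. As [K] does not depend on [s], the precision
    [d] can be chosen after it. *)
Lemma eval_approx (h : formula_algebra S void -> expand G) a : is_hom h ->
  exists2 K : R, 0 <= K &
    forall (s : substitution) d, is_hom s ->
      0 <= d -> (forall k, `|val (h (Var k)) - w (s (Var k))| <= d) ->
    `|val (h a) - w (s a)| <= K * d.
Proof.
move=> hh; elim: a => [k | [] | | a [K K0 IHa] b [L L0 IHb] | f x IHx].
- by exists 1 => // s d _ _; rewrite mul1r.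
- exists 0 => // s d hs _ _.
  by rewrite [h _](hom_bot hh) [s _](hom_bot hs) V_bot subrr normr0 mul0r.
- exists (K + L) => [|s d hs d0 hd]; first exact: addr_ge0.
  have := IHa s d hs d0 hd; have := IHb s d hs d0 hd.
  have -> : h (a ~> b) = imp01 (h a) (h b) by exact: hom_imp hh a b.
  rewrite [s (Imp _ _)](hom_imp hs) V_imp !val_imp01 mulrDl.
  move: (K * d) (L * d) => k l.
  rewrite !ler_norml => /andP[? ?] /andP[? ?]; apply/andP.
  by case: (leP 1 (1 - val (h a) + _)); case: (leP 1 (1 - w (s a) + _)); lra.
- pose K i := s2val (cid2 (IHx i)).
  have [N N0 GN] := V_op f.
  exists (N * \sum_i K i) => [|s d hs d0 hd].
    by rewrite mulr_ge0 // sumr_ge0 // => i _; exact: (s2valP (cid2 (IHx i))).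
  rewrite [h (Op _)](hom_op hh) [s (Op _)](hom_op hs).
  apply: le_trans (GN _ _) _; rewrite -mulrA ler_wpM2l // mulr_suml.
  by apply: ler_sum => i _; exact: (s2valP' (cid2 (IHx i))).
Qed.

(** An equation of [E] yields derivable implications in both directions, which [V] satisfies under
    every substitution. By density these substitutions approximate any homomorphism [h], with
    arbitrarily small error. *)
Lemma approx_is_expansion : is_mv (standard_mv R) -> is_expansion E G.
Proof.
move=> mvR; split; first by case: mvR => *; split.
have [cons equiv] := AxE.
have half t1 t2 (h : formula_algebra S void -> expand G) : is_hom h ->
    (forall B, in_variety E B ->
      forall k : formula_algebra S void -> B, is_hom k -> k t1 = k t2) ->
    val (h t1) <= val (h t2).
  move=> hh Et.
  have der : derives (sigma_axiom Ax) set0 (t1 ~> t2).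
    apply/cons => B VB k hk _.
    have kI a b : k (a ~> b) = imp (k a) (k b) := hom_imp hk a b.
    by rewrite !kI (Et _ VB _ hk) !(mv_impxx _ VB.1).
  have [K1 K10 HK1] := eval_approx t1 hh.
  have [K2 K20 HK2] := eval_approx t2 hh.
  apply/ler_addgt0Pr => e e0.
  (* The summand 1 keeps the divisor positive even if both constants are 0; the total error
     [(K1 + K2) * d] is at most [e]. *)
  pose d := e / (K1 + K2 + 1).
  have K0 : 0 < K1 + K2 + 1 by lra.
  have d0 : 0 < d by exact: divr_gt0.
  have [x xd] := choice (fun k => V_dense (h (Var k)) d0).
  pose s := eval (A := formula_algebra S C) x.
  have hs : is_hom (A := formula_algebra S void) s by exact: eval_hom.
  have hd k : `|val (h (Var k)) - w (s (Var k))| <= d.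
    by rewrite distrC; exact: xd.
  (* A derivation without hypotheses has defect at most [N * 0], so the implication gets value 1. *)
  have st : w (s t1) <= w (s t2).
    have [N _ /(_ s hs)] := derives_defect (D := fun=> 0)
      (fun=> lexx 0) (fun _ _ => False_ind _) der.
    by rewrite mulr0 V_imp val_imp01; case: (leP 1 _); lra.
  have := HK1 s d hs (ltW d0) hd; have := HK2 s d hs (ltW d0) hd.
  have : (K1 + K2) * d <= e.
    by rewrite mulrA ler_pdivrMr // mulrC ler_pM2l // lerDl.
  by rewrite mulrDl !ler_norml => ? /andP[? ?] /andP[? ?]; lra.
move=> t1 t2 Et h hh; apply: val_inj; apply: le_anti; apply/andP.
by split; apply: half => // B VB k hk; [|symmetry]; exact: (VB.2 _ _ Et).
Qed.

End Approximation.

(** The McShane extensions [G] of the connectives form an [E]-expansion, so uniqueness identifies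
    them with [F]. *)
Lemma canonical_hom (F : operations S (standard_mv R)) :
  canonical_expansion E F ->
  is_hom (A := formula_algebra S C) (B := expand F) V.
Proof.
move=> [[mvF _] Funiq _].
pose N f := s2val (cid2 (op_lipschitz f)).
have N0 f : 0 <= N f by exact: (s2valP (cid2 (op_lipschitz f))).
pose ext f (z : 'I_(arity f) -> I01 R) := cid (lipschitz_extension
  (val \o z) (N0 f) (s2valP' (cid2 (op_lipschitz f)))).
pose G : operations S (standard_mv R) := fun f z => projT1 (ext f z).
have GE f z x : `|val (G f z : I01 R) - w (Op x)| <=
  N f * \sum_i `|val (z i) - w (x i)| by exact: (projT2 (ext f z)).
have GF : eq_operations G F.
  apply: Funiq; apply: approx_is_expansion => [f|].
    by exists (N f) => // z x; exact: GE.
  by case: mvF => *; split.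
split=> [|a b|f x] /=; [exact: val_inj | exact: V_imp |].
(* At values of [V] itself the Lipschitz estimate has right-hand side 0, so there [G] agrees with
   [V]. *)
rewrite -[RHS]GF; apply: val_inj; apply/esym/eqP; rewrite -subr_eq0.
rewrite -normr_le0; apply: le_trans (GE f _ x) _.
by rewrite big1 ?mulr0 // => i _; rewrite subrr normr0.
Qed.

End LipschitzExtension.

(** * The valuation of a linear theory *)

Section Degrees.
Variable R : realType.

Lemma rat01_bounds (r : I01 rat) : 0 <= rat01 R r /\ rat01 R r <= 1.
Proof.
have [r0 r1] := I01_bounds r; rewrite /rat01; split; first by rewrite ler0q.
by rewrite -(rmorph1 (@ratr R)) ler_rat.
Qed.

Lemma rat01_0 : rat01 R (zero01 rat) = 0.
Proof. exact: rmorph0. Qed.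

Lemma rat01_imp (r s : I01 rat) :
  rat01 R (imp01 r s) = Num.min 1 (1 - rat01 R r + rat01 R s).
Proof.
have -> : 1 - rat01 R r + rat01 R s = ratr (1 - val r + val s).
  by rewrite rmorphD rmorphB rmorph1.
rewrite /rat01 val_imp01 -[1 in RHS](rmorph1 (@ratr R)).
have [h | /ltW h] := leP 1 (1 - val r + val s).
  by rewrite min_l // ler_rat.
by rewrite min_r // ler_rat.
Qed.

Lemma rat01_dense (x y : R) : 0 <= x -> y <= 1 -> x < y ->
  exists r : I01 rat, x < rat01 R r /\ rat01 R r < y.
Proof.
move=> x0 y1 /rat_in_itvoo[q]; rewrite in_itv /= => /andP[xq qy].
have q01 : 0 <= q <= 1.
  rewrite -(ler0q R) -[q <= 1](ler_rat R) rmorph1.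
  by rewrite (le_trans x0 (ltW xq)) (le_trans (ltW qy)).
by exists (Sub q q01); rewrite /rat01 SubK.
Qed.

Lemma proof_degree_ge S (T : set (formula S (I01 rat))) r a :
  T (Imp (Const r) a) -> rat01 R r <= proof_degree R T a.
Proof.
move=> Tra; apply: ub_le_sup; last by right; exists r.
by exists 1 => _ [-> | [s _ ->]] //; have [] := rat01_bounds s.
Qed.

Lemma proof_degree_le S (T : set (formula S (I01 rat))) a (x : R) : 0 <= x ->
  (forall r, T (Imp (Const r) a) -> rat01 R r <= x) -> proof_degree R T a <= x.
Proof.
move=> x0 Tx; apply: ge_sup; first by exists 0; left.
by move=> _ [-> | [r Tr ->]] //; exact: Tx.
Qed.

Lemma proof_degree01 S (T : set (formula S (I01 rat))) a :
  0 <= proof_degree R T a <= 1.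
Proof.
rewrite proof_degree_le // ?andbT; last first.
  by move=> r _; have [] := rat01_bounds r.
apply: ub_le_sup; last by left.
by exists 1 => _ [-> | [s _ ->]] //; have [] := rat01_bounds s.
Qed.

Lemma truth_degree_le S (F : operations S (standard_mv R)) T a
    (v : formula_algebra S (I01 rat) -> expand F) :
  is_valuation v -> (forall b, T b -> val (v b : I01 R) = 1) ->
  truth_degree F T a <= val (v a : I01 R).
Proof.
move=> vF vT; apply: ge_inf; last by right; exists v.
by exists 0 => _ [-> //| [u [_ _ ->]]]; case: (I01_bounds (u a)).
Qed.

Lemma truth_degree_le1 S (F : operations S (standard_mv R)) T a :
  truth_degree F T a <= 1.
Proof.
apply: ge_inf; last by left.
by exists 0 => _ [-> //| [u [_ _ ->]]]; case: (I01_bounds (u a)).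
Qed.

Lemma truth_degree_ge S (F : operations S (standard_mv R)) T a (x : R) :
  x <= 1 -> (forall v : formula_algebra S (I01 rat) -> expand F,
    is_valuation v -> (forall b, T b -> val (v b : I01 R) = 1) ->
    x <= val (v a : I01 R)) ->
  x <= truth_degree F T a.
Proof.
move=> x1 xv; apply: lb_le_inf; first by exists 1; left.
by move=> _ [-> | [v [vF vT ->]]] //; exact: xv.
Qed.

End Degrees.

Section LinearTheory.
Context {R : realType} {S : signature}.
Local Notation "a ~> b" := (@Imp S _ a b) (at level 55, right associativity).
Variables (Ax : set (formula S void)) (F : operations S (standard_mv R)).
Local Notation ax := (pavelka_axiom Ax F).

Lemma pavelka_luk : luk_axiom `<=` ax.
Proof. by move=> a la; exact/pavelka_sigma/sigma_luk. Qed.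

Lemma pavelka_prelinear E G a b : algebraizable Ax E ->
  derives ax G (((a ~> b) ~> b ~> a) ~> b ~> a).
Proof.
move=> AxE; elim: (derives_prelinear G a b AxE) => {a b} [a | a axa | a b].
- exact: der_hyp.
- by apply: der_axiom; exact: pavelka_sigma.
- by move=> _ Ga _; exact: der_mp Ga.
Qed.

Variable M : set (formula S (I01 rat)).
Hypothesis M_theory : is_theory Ax F M.
Hypothesis M_consistent : ~ M Bot.
Hypothesis M_linear : forall a b, M (a ~> b) \/ M (b ~> a).
Implicit Types (a b : formula S (I01 rat)) (r s : I01 rat).

Let M_ax a : ax a -> M a.
Proof. by move=> axa; apply/M_theory/der_axiom. Qed.

Let M_mp a b : M a -> M (a ~> b) -> M b.
Proof.
by move=> Ma Mab; apply: M_theory; apply: (@der_mp _ _ _ _ a); exact: der_hyp.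
Qed.

Let M_trans a b c : M (a ~> b) -> M (b ~> c) -> M (a ~> c).
Proof.
move=> Mab Mbc; apply: M_theory.
by apply: (derives_trans pavelka_luk (b := b)); exact: der_hyp.
Qed.

Let M_suffix a b c : M (a ~> b) -> M ((b ~> c) ~> a ~> c).
Proof. by move=> Mab; apply/M_theory/(derives_suffix pavelka_luk)/der_hyp. Qed.

Let M_prefix a b c : M (b ~> c) -> M ((a ~> b) ~> a ~> c).
Proof. by move=> Mab; apply/M_theory/(derives_prefix pavelka_luk)/der_hyp. Qed.

Let M_weak a b : M b -> M (a ~> b).
Proof. by move=> Mb; apply/M_theory/(derives_weak pavelka_luk)/der_hyp. Qed.

Let M_id a : M (a ~> a).
Proof. exact/M_theory/(derives_id pavelka_luk). Qed.

Let M_exfalso a : M (Bot ~> a).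
Proof. exact/M_theory/(derives_exfalso pavelka_luk). Qed.

Lemma theory_bk_lr r s : M ((Const r ~> Const s) ~> Const (imp01 r s)).
Proof. by apply: M_ax; apply: bk_imp; exact: iff_lr. Qed.

Lemma theory_bk_rl r s : M (Const (imp01 r s) ~> Const r ~> Const s).
Proof. by apply: M_ax; apply: bk_imp; exact: iff_rl. Qed.

Lemma theory_const1 r : val r = 1 -> M (Const r).
Proof.
(* The value 1 is [0 -> 0], so book-keeping derives its constant from an instance of [a ~> a]. *)
move=> r1; have -> : r = imp01 (zero01 rat) (zero01 rat).
  by apply: val_inj; rewrite r1.
by apply: M_mp (theory_bk_lr _ _); exact: M_id.
Qed.

(* If c < 1 were in the theory, then modus ponens with the book-keeping
   axioms would lower the constants of the theory by steps of 1 - c, down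
   to 0. *)
Lemma theory_const_eq1 c : M (Const c) -> val c = 1.
Proof.
move=> Mc; have [c0 c1] := I01_bounds c.
apply: le_anti; rewrite c1 /= leNgt; apply/negP => ltc1.
have H k d : 1 - k%:R * (1 - val c) <= val d -> M (Const d).
  elim: k d => [|k IHk] d kd; have [d0 d1] := I01_bounds d.
    by apply: theory_const1; lra.
  have /IHk Mcd : 1 - k%:R * (1 - val c) <= val (imp01 c d).
    rewrite val_imp01 le_min; apply/andP; split.
      by rewrite gerBl mulr_ge0 // subr_ge0.
    by move: kd; rewrite -natr1 mulrDl; lra.
  by apply: M_mp Mc _; apply: M_mp Mcd _; exact: theory_bk_rl.
apply: M_consistent; apply: (@M_mp (Const (zero01 rat))); last first.
  by apply: M_ax; apply: bk_bot; exact: iff_lr.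
have c1' : 0 < 1 - val c by rewrite subr_gt0.
(* The Archimedean property gives enough steps of length [1 - val c] to cover the unit interval. *)
apply: (H (Num.bound (1 - val c)^-1)).
have /archi_boundP/ltW : 0 <= (1 - val c)^-1 by rewrite invr_ge0 ltW.
by rewrite -(ler_pM2r c1') mulVf ?gt_eqF //= subr_le0.
Qed.

(** Book-keeping turns the implication into a single constant of the theory, whose value must be
    1. *)
Lemma theory_const_le r s : M (Const r ~> Const s) -> val r <= val s.
Proof.
move=> /M_mp/(_ (theory_bk_lr _ _))/theory_const_eq1.
by rewrite val_imp01; case: (leP 1 _); lra.
Qed.

Lemma theory_const0 a : M (Const (zero01 rat) ~> a).
Proof.
apply: M_trans (M_exfalso a); apply: M_ax; apply: bk_bot; exact: iff_lr.
Qed.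

Local Notation w a := (proof_degree R M a).

Lemma proof_degree_le_const a s : M (a ~> Const s) -> w a <= rat01 R s.
Proof.
move=> Mas; apply: proof_degree_le; first by have [] := rat01_bounds R s.
by move=> r /M_trans/(_ Mas)/theory_const_le; rewrite /rat01 ler_rat.
Qed.

Lemma proof_degree_const r : w (Const r) = rat01 R r.
Proof.
by apply: le_anti; rewrite proof_degree_ge ?proof_degree_le_const //.
Qed.

Lemma proof_degree_mem a : M a -> w a = 1.
Proof.
move=> Ma; have /andP[_ a1] := proof_degree01 R M a.
apply: le_anti; rewrite a1.
pose one := imp01 (zero01 rat) (zero01 rat).
have := proof_degree_ge R (M_weak (Const one) Ma).
by rewrite rat01_imp subrK minxx.
Qed.

(** Linearity decides between [Const r ~> a] and [a ~> Const r]; for [r] strictly below the degree,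
    the latter would bound the degree by [r]. When [w a <= e] the constant 0 serves. *)
Lemma proof_degree_lower a (e : R) : 0 < e ->
  exists2 r, M (Const r ~> a) & w a - e <= rat01 R r.
Proof.
move=> e0; have /andP[a0 a1] := proof_degree01 R M a.
have [ae | ea] := leP (w a) e.
  exists (zero01 rat); first exact: theory_const0.
  by rewrite rat01_0 subr_le0.
have [|||r [ar ra]] := @rat01_dense R (w a - e) (w a); [lra | lra | lra |].
exists r; last exact: ltW.
have [//|/proof_degree_le_const] := M_linear (Const r) a.
by rewrite leNgt ra.
Qed.

Lemma proof_degree_upper a (e : R) : 0 < e ->
  exists2 r, M (a ~> Const r) & rat01 R r <= w a + e.
Proof.
move=> e0; have /andP[a0 a1] := proof_degree01 R M a.
have [ae | ea] := leP 1 (w a + e).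
  exists (imp01 (zero01 rat) (zero01 rat)).
    by apply: M_weak; exact: theory_const1.
  by rewrite rat01_imp subrK minxx.
have [|||r [ar ra]] := @rat01_dense R (w a) (w a + e); [lra | lra | lra |].
exists r; last exact: ltW.
have [/(proof_degree_ge R)|//] := M_linear (Const r) a.
by rewrite leNgt ar.
Qed.

(** Implication is antitone on the left and monotone on the right, so constants within [e / 2] of
    [a] and [b], on suitable sides, bound it; book-keeping evaluates it on the constants. *)
Lemma proof_degree_imp a b : w (a ~> b) = Num.min 1 (1 - w a + w b).
Proof.
apply: le_anti; apply/andP; split; apply/ler_addgt0Pr => e e0.
  have e2 : 0 < e / 2 by rewrite divr_gt0.
  have [r Mra ar] := proof_degree_lower a e2.
  have [s Mbs bs] := proof_degree_upper b e2.
  have : w (a ~> b) <= rat01 R (imp01 r s).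
    apply: proof_degree_le_const; apply: M_trans (theory_bk_lr _ _).
    by apply: M_trans (M_suffix _ Mra) (M_prefix _ Mbs).
  rewrite rat01_imp => /le_trans; apply.
  by case: (leP 1 (1 - w a + _)); case: (leP 1 (1 - rat01 R r + _)); lra.
have e2 : 0 < e / 2 by rewrite divr_gt0.
have [r Mas as_] := proof_degree_upper a e2.
have [s Mrb rb] := proof_degree_lower b e2.
have : rat01 R (imp01 r s) <= w (a ~> b).
  apply: proof_degree_ge; apply: M_trans (theory_bk_rl _ _) _.
  by apply: M_trans (M_suffix _ Mas) (M_prefix _ Mrb).
rewrite rat01_imp.
by case: (leP 1 (1 - w a + _)); case: (leP 1 (1 - rat01 R r + _)); lra.
Qed.

Lemma linear_theory_valuation E : algebraizable Ax E ->
  canonical_expansion E F ->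
  exists v : formula_algebra S (I01 rat) -> expand F,
    is_valuation v /\ forall a, val (v a : I01 R) = w a.
Proof.
move=> AxE EF; pose V a : I01 R := Sub (w a) (proof_degree01 R M a).
exists V; split=> //; split=> [|r]; last exact: proof_degree_const.
apply: (@canonical_hom _ _ _ Ax E) => //.
- rewrite SubK; apply: le_anti; have /andP[-> _] := proof_degree01 R M Bot.
  have := proof_degree_le_const (M_exfalso (Const (zero01 rat))).
  by rewrite rat01_0 => ->.
- by move=> a b; apply: val_inj; exact: proof_degree_imp.
- by move=> a axa; apply: proof_degree_mem; exact/M_ax/pavelka_sigma.
(* The constants already have dense values. The case [val x <= e] is separate because the interval
   in [rat01_dense] must start at a nonnegative number. *)
- move=> x e e0; have [x0 x1] := I01_bounds x.
  have [xe | ex] := leP (val x) e.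
    exists (Const (zero01 rat)).
    rewrite SubK proof_degree_const rat01_0 sub0r normrN.
    by rewrite ger0_norm.
  have [|||r [ar ra]] := @rat01_dense R (val x - e) (val x);
    [lra | lra | lra |].
  exists (Const r); rewrite SubK proof_degree_const ler_norml.
  by apply/andP; lra.
Qed.

End LinearTheory.

(** * Soundness and completeness with respect to degrees *)

Theorem theorem2p8 (R : realType) (S : signature)
  (Ax : set (formula S void)) (E : equations S)
  (hL : admissible_expansion R Ax E)
  (F : operations S (standard_mv R)) (hF : canonical_expansion E F)
  (T : set (formula S (I01 rat))) (hT : is_theory Ax F T)
  (phi : formula S (I01 rat)) :
  proof_degree R T phi = truth_degree F T phi.
Proof.
have [AxE _] := hL; have luk := @pavelka_luk _ _ Ax F.
have /andP[p0 p1] := proof_degree01 R T phi.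
apply: le_anti; apply/andP; split.
  apply: truth_degree_ge => // v vF vT.
  apply: proof_degree_le => [|r /vT]; first by case: (I01_bounds (v phi)).
  have -> : v (Imp (Const r) phi) = imp01 (v (Const r)) (v phi).
    exact: (hom_imp (valuation_hom vF)).
  by rewrite val_imp01 (valuation_const vF); case: (leP 1 _); lra.
rewrite leNgt; apply/negP => lt_pt.
have [r [pr rt]] := rat01_dense p0 (truth_degree_le1 F T phi) lt_pt.
have nTr : ~ derives (pavelka_axiom Ax F) T (Imp (Const r) phi).
  by move=> /hT/(proof_degree_ge R); rewrite leNgt pr.
have [M [TM Mth nMr Mlin]] :=
  linear_extension luk (fun G a b => pavelka_prelinear F G a b AxE) nTr.
(* An inconsistent [M] would contain [Const r ~> phi] by ex falso. *)
have Mcons : ~ M Bot.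
  move=> /der_hyp MB; apply/nMr/Mth; apply: der_mp (MB _) _.
  exact: derives_exfalso.
have [v [vF vM]] := linear_theory_valuation Mth Mcons Mlin AxE hF.
(* The remaining case [phi ~> Const r] puts the value of [phi] under [v] at most at [r], strictly
   below the truth degree, although [v] is among the valuations in the meet. *)
have [//|/(proof_degree_le_const Mth Mcons)] := Mlin (Const r) phi.
apply/negP; rewrite -ltNge; apply: lt_le_trans rt _; rewrite -vM.
apply: truth_degree_le => // b /TM Mb; rewrite vM.
exact: (proof_degree_mem Mth).
Qed.
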